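(* Let $\eta\in\{123,321\}$. (i) Let $2\le k\le n$ and define $\tau^*(\eta)\in S_k^{\text{av}(\eta)}$ by $\tau^*(\eta)=k\cdots1$ (the decreasing permutation of $[k]$) if $\eta=123$, and $\tau^*(\eta)=1\cdots k$ (the increasing permutation) if $\eta=321$. For $\tau\in S_k^{\text{av}(\eta)}$, $$E_n^{\text{av}(\eta)}N_n^{(k;\tau)}=\begin{cases}\dfrac{C_{n-k+1}}{C_n}, & \text{if } \tau\neq\tau^*(\eta);\\[2mm] (n-k+1)\dfrac{C_{n-k+1}}{C_n}, & \text{if } \tau=\tau^*(\eta).\end{cases}$$ (ii) For $2\le k\le n$, $$E_n^{\text{av}(\eta)}N_n^{(k)}=\frac{C_{n-k+1}(n-k+C_k)}{C_n}.$$
   Context: $S_n$ is the set of permutations $\sigma=\sigma_1\cdots\sigma_n$ of $[n]=\{1,\dots,n\}$. A permutation $\sigma\in S_n$ contains $\eta\in S_m$ ($m\le n$) as a pattern if there are indices $1\le i_1<\cdots<i_m\le n$ such that for all $1\le j,k\le m$, $\sigma_{i_j}<\sigma_{i_k}$ if and only if $\eta_j<\eta_k$; otherwise $\sigma$ avoids $\eta$. $S_n^{\text{av}(\eta)}$ is the set of $\sigma\in S_n$ avoiding $\eta$ (and $S_n^{\text{av}(\eta)}=S_n$ if $n<m$). $P_n^{\text{av}(\eta)}$ is the uniform probability measure on $S_n^{\text{av}(\eta)}$ and $E_n^{\text{av}(\eta)}$ is the corresponding expectation. For $2\le k\le n$, $\tau\in S_k^{\text{av}(\eta)}$ and $\sigma\in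 S_n^{\text{av}(\eta)}$, $N_n^{(k;\tau)}(\sigma)$ is the number of occurrences of $k$ consecutive numbers appearing in $k$ consecutive positions of $\sigma$ in the order given by $\tau$, i.e. the number of pairs $(l,m)$ with $1\le l,m\le n-k+1$ such that $\{l,l+1,\dots,l+k-1\}=\{\sigma_m,\dots,\sigma_{m+k-1}\}$ and $\tau_i=\sigma_{m+i-1}-(l-1)$ for $i=1,\dots,k$. Further, $N_n^{(k)}(\sigma)=\sum_{\tau\in S_k^{\text{av}(\eta)}}N_n^{(k;\tau)}(\sigma)$. $C_n=\frac1{n+1}\binom{2n}{n}$ is the $n$th Catalan number. *)

(* Defs.v *)
From mathcomp Require Import all_boot all_order all_fingroup all_algebra.

Set Implicit Arguments.
Unset Strict Implicit.
Unset Printing Implicit Defensive.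

Import GRing.Theory Num.Theory.

Local Open Scope ring_scope.

(* Positions and values are 0-based: a permutation s_1 ... s_n of [n] is the
   s : 'S_n whose value at i is s_{i+1} - 1. *)

Definition contains (m n : nat) (s : 'S_n) (eta : 'S_m) : bool :=
  [exists f : {ffun 'I_m -> 'I_n},
     [forall i : 'I_m, forall j : 'I_m, (i < j)%N ==> (f i < f j)%N] &&
     [forall j : 'I_m, forall k : 'I_m, (s (f j) < s (f k))%N == (eta j < eta k)%N]].

Definition av (m : nat) (eta : 'S_m) (n : nat) : {set 'S_n} :=
  [set s : 'S_n | ~~ contains s eta].

Definition incr_perm (k : nat) : 'S_k := 1%g.

Definition decr_perm (k : nat) : 'S_k := perm (@rev_ord_inj k).

Definition perm123 : 'S_3 := incr_perm 3.

Definition perm321 : 'S_3 := decr_perm 3.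

Definition tau_star (eta : 'S_3) (k : nat) : 'S_k :=
  if eta == perm123 then decr_perm k else incr_perm k.

(* The 0-based pair (l, m) stands for the pair (l + 1, m + 1); the bound
   n.+1 - k equals n - k + 1 for k <= n and is 0 otherwise. *)
Definition cluster_at (k n : nat) (tau : 'S_k) (s : 'S_n) (l m : nat) : bool :=
  ([set v : 'I_n | (l <= v < l + k)%N]
     == [set s i | i : 'I_n & (m <= i < m + k)%N]) &&
  [forall i : 'I_k, forall p : 'I_n,
     (p == m + i :> nat) ==> (s p == l + tau i :> nat)].

Definition num_cluster (k n : nat) (tau : 'S_k) (s : 'S_n) : nat :=
  #|[set lm : 'I_(n.+1 - k) * 'I_(n.+1 - k) | cluster_at tau s lm.1 lm.2]|.

Definition num_cluster_all (m : nat) (eta : 'S_m) (k n : nat) (s : 'S_n) : nat :=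
  (\sum_(tau in av eta k) num_cluster tau s)%N.

Definition unif_prob (R : realFieldType) (T : finType) (A : {set T}) (x : T) : R :=
  if x \in A then #|A|%:R^-1 else 0.

Definition expectation (R : realFieldType) (T : finType) (P : T -> R)
    (X : T -> R) : R :=
  \sum_x P x * X x.

Definition Eav (R : realFieldType) (m : nat) (eta : 'S_m) (n : nat)
    (X : 'S_n -> nat) : R :=
  expectation (unif_prob R (av eta n)) (fun s => (X s)%:R).

Definition catalan (R : realFieldType) (n : nat) : R :=
  n.+1%:R^-1 * 'C(2 * n, n)%:R.

Lemma tau_star_av (eta : 'S_3) (k : nat) :
  eta = perm123 \/ eta = perm321 -> tau_star eta k \in av eta k.
Proof.
have ne : perm321 != perm123.
  by apply/eqP => /permP/(_ ord0)/(congr1 val); rewrite perm1 permE.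
case=> ->; rewrite /tau_star ?eqxx ?(negbTE ne) inE;
  apply/negP => /existsP [f /andP [/forallP inc /forallP pat]];
  move: (forallP (inc ord0) ord_max) (forallP (pat ord0) ord_max).
- rewrite /decr_perm /incr_perm !permE /= => lt01 /eqP.
  by rewrite ltn_sub2lE // ltnS leqNgt ltnW.
- rewrite /perm321 /decr_perm /incr_perm !permE /= => lt01 /eqP.
  by rewrite lt01.
Qed.

(* Main.v *)
Require Import Defs.
From mathcomp Require Import all_boot all_order all_fingroup all_algebra.
From mathcomp Require Import zify.

Set Implicit Arguments.
Unset Strict Implicit.
Unset Printing Implicit Defensive.

Import GRing.Theory Num.Theory.

(** Reversing the positions exchanges the patterns 123 and 321, the increasing
and the decreasing permutation, and the clusters of a pattern with those of the
reversed pattern ([contains_rev], [num_cluster_rev]); so let eta = 321, and let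
N = n - k + 1.

The sum of the cluster counts over the 321-avoiding permutations of [n] is the
number of triples (s, l, m) such that s has a cluster of shape tau at values l
and positions m.  Such a triple contracts to the pair (pi, m), where pi in S_N
is obtained by shrinking the cluster to the single point (m, l), and inflating
that point by tau recovers s ([collapseK], [inflateK]).  When does the inflation
avoid 321?  A decreasing triple of the inflation either lives over three
different points of pi, or inside the cluster, or uses two points of the cluster
and one outside.  The first two are excluded when pi and tau avoid 321.  The
third consists of a descent of tau and an inversion of pi through m, so it is
excluded exactly when tau is the identity or no inversion of pi involves m
([av321_inflate]).

For tau = id every point of every pi may be inflated, which gives N * C_N pairs.
Otherwise m has to be involved in no inversion, hence it is a fixed point of pi
with all smaller values to the left and all larger ones to the right: pi is a
direct sum A + 1 + B of two 321-avoiders around m, and the number of pairs is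
the sum of the C_m C_(N-1-m), which is C_N by the Catalan convolution
([sum_card_strong_fixed]).  Part (ii) is the sum of (i) over tau.

That C_n counts the 321-avoiders of [n] is proved by deleting the largest value,
keeping track of the length of the final increasing run.  If b(n, L) counts the
321-avoiders whose last L entries increase, then
b(n+1, L+1) = b(n+1, L+2) + b(n, L), which is the recurrence of the ballot
numbers (L+1) / (n+1) * binomial (2n-L, n) ([card_suffix_rec], [card_suffix]). *)

(** * Permutations as functions on natural numbers *)

(** Positions and values are natural numbers in all the constructions below, so
that shifting an index involves no change of ordinal type and the case analyses
are linear arithmetic.  Beyond [n] the value of [val_at] is the junk value [i]. *)
Definition val_at n (s : 'S_n) (i : nat) : nat :=
  oapp (fun j : 'I_n => s j : nat) i (insub i).

Lemma val_atE n (s : 'S_n) (i : 'I_n) : val_at s i = s i.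
Proof. by rewrite /val_at valK. Qed.

Lemma val_at_lt n (s : 'S_n) i : i < n -> val_at s i < n.
Proof. by move=> lt; rewrite -[i]/(val (Ordinal lt)) val_atE. Qed.

Lemma val_at_inj n (s : 'S_n) i j :
  i < n -> j < n -> val_at s i = val_at s j -> i = j.
Proof.
move=> lti ltj; rewrite -[i]/(val (Ordinal lti)) -[j]/(val (Ordinal ltj)).
by rewrite !val_atE => /val_inj/perm_inj ->.
Qed.

Lemma eq_val_at n (s t : 'S_n) :
  (forall i, i < n -> val_at s i = val_at t i) -> s = t.
Proof.
move=> st; apply/permP => i; apply: val_inj; rewrite /=.
by rewrite -(val_atE s) -(val_atE t) st.
Qed.

Definition permutes n (f : nat -> nat) : Prop :=
  (forall i, i < n -> f i < n) /\
  (forall i j, i < n -> j < n -> f i = f j -> i = j).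

(** The permutation given by a formula on natural numbers; it is meaningful only
if the formula [permutes n]. *)
Definition perm_of_nat n (f : nat -> nat) : 'S_n :=
  insubd (1%g : 'S_n) [ffun i : 'I_n => insubd i (f i)].

Lemma val_at_perm_of_nat n f i :
  permutes n f -> i < n -> val_at (perm_of_nat n f) i = f i.
Proof.
case=> f_lt f_inj lti; rewrite -[i]/(val (Ordinal lti)) val_atE /=.
have fE (j : 'I_n) : insubd j (f j) = f j :> nat.
  by rewrite val_insubd f_lt.
have inj : injectiveb [ffun i : 'I_n => insubd i (f i)].
  apply/injectiveP => a b; rewrite !ffunE => /(congr1 (@nat_of_ord n)).
  by rewrite !fE => ab; apply: val_inj; exact: f_inj ab.
have -> : perm_of_nat n f = Perm inj.
  by apply: val_inj; rewrite /perm_of_nat insubdK.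
by rewrite unlock /= ffunE fE.
Qed.

Lemma val_at_surj n (s : 'S_n) v : v < n -> exists2 i, i < n & val_at s i = v.
Proof.
move=> vn; exists ((s^-1)%g (Ordinal vn) : nat); first exact: ltn_ord.
by rewrite val_atE permKV.
Qed.

Lemma eqn_val_at n (s : 'S_n) i j :
  i < n -> j < n -> (val_at s i == val_at s j) = (i == j).
Proof.
by move=> lti ltj; apply/eqP/eqP => [|-> //]; apply: val_at_inj.
Qed.

Lemma av321P n (s : 'S_n) :
  reflect (forall a b c, a < b -> b < c -> c < n ->
             ~ (val_at s c < val_at s b /\ val_at s b < val_at s a))
          (s \in av perm321 n).
Proof.
rewrite inE; apply: (iffP negP) => [no a b c ab bc cn [cb ba]|no].
  have bn := ltn_trans bc cn; have an := ltn_trans ab bn.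
  apply: no; apply/existsP.
  exists [ffun i : 'I_3 => if i == 0 :> nat then Ordinal an
                  else if i == 1 :> nat then Ordinal bn else Ordinal cn].
  move: cb ba; rewrite -[a]/(val (Ordinal an)) -[b]/(val (Ordinal bn)).
  rewrite -[c]/(val (Ordinal cn)) !val_atE => cb ba.
  apply/andP; split; apply/forallP => -[[|[|[|//]]] i3];
    apply/forallP => -[[|[|[|//]]] j3]; rewrite !ffunE ?permE /=; lia.
case/existsP=> f /andP [/forallP inc /forallP pat].
pose i0 : 'I_3 := ord0; pose i1 : 'I_3 := inord 1; pose i2 : 'I_3 := ord_max.
have i1E : i1 = 1 :> nat by rewrite inordK.
have := forallP (inc i0) i1; have := forallP (inc i1) i2.
have := forallP (pat i1) i0; have := forallP (pat i2) i1.
rewrite !permE /= !i1E /= !subSS -!val_atE.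
move=> /eqP h1 /eqP h2 h3 h4.
by apply: (no _ _ _ h4 h3 (ltn_ord _)); rewrite h1 h2.
Qed.

Ltac case_ifs :=
  repeat match goal with
  | |- context [if ?b then _ else _] =>
      lazymatch b with
      | context [if _ then _ else _] => fail
      | _ => case: (boolP b) => ? /=
      end
  end.

(** [use t] adds the fact [t] with its premises discharged by [lia], or nothing
if one of them is out of reach.  Handing implications to [lia] itself would make
it branch on every premise. *)
Ltac discharge_in H :=
  lazymatch type of H with
  | ?P -> _ => let h := fresh in
      first [ assert (h : P) by lia; specialize (H h); clear h; discharge_in H
            | clear H ]
  | _ => idtac
  end.
Ltac use t := let H := fresh "fact" in pose proof t as H; discharge_in H.

Lemma card_bij_in (T U : finType) (A : {set T}) (B : {set U}) f g :
  (forall x, x \in A -> f x \in B /\ g (f x) = x) ->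
  (forall y, y \in B -> g y \in A /\ f (g y) = y) -> #|A| = #|B|.
Proof.
move=> fP gP; rewrite -(card_in_imset (f := f) (D := mem A)).
  apply: eq_card => y; apply/imsetP/idP => [[x xA ->]|yB].
    by case: (fP x xA).
  by have [gyA fgy] := gP y yB; exists (g y).
by move=> x y /fP [_ gx] /fP [_ gy] fxy; rewrite -gx fxy gy.
Qed.

(** * 321-avoiding permutations are counted by the Catalan numbers *)

Definition incr_from n d (s : 'S_n) : bool :=
  [forall i : 'I_n, forall j : 'I_n, (d <= i < j) ==> (s i < s j)].

Lemma incr_fromP n d (s : 'S_n) :
  reflect (forall i j, d <= i -> i < j -> j < n -> val_at s i < val_at s j)
          (incr_from d s).
Proof.
apply: (iffP forallP) => [inc i j di ij jn|inc i].
  have := forallP (inc (Ordinal (ltn_trans ij jn))) (Ordinal jn).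
  by rewrite /= di ij /= -!val_atE.
by apply/forallP => j; apply/implyP => /andP [di ij]; rewrite -!val_atE inc.
Qed.

Definition insert_max n q (s : 'S_n) : 'S_n.+1 :=
  perm_of_nat n.+1 (fun p => if p < q then val_at s p
                             else if p == q then n else val_at s p.-1).

Definition delete_at n q (s : 'S_n.+1) : 'S_n :=
  perm_of_nat n (fun p => if p < q then val_at s p else val_at s p.+1).

Lemma val_at_insert_max n q (s : 'S_n) p : q <= n -> p <= n ->
  val_at (insert_max q s) p =
  if p < q then val_at s p else if p == q then n else val_at s p.-1.
Proof.
move=> qn pn; rewrite val_at_perm_of_nat // /permutes; split=> [i|i j] lti.
  by case_ifs; use (@val_at_lt n s i); use (@val_at_lt n s i.-1); lia.
have lt1 := @val_at_lt n s; have inj := @val_at_inj n s.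
by case_ifs => ltj e; use (lt1 i); use (lt1 i.-1); use (lt1 j);
  use (lt1 j.-1); use (inj i j); use (inj i j.-1); use (inj i.-1 j);
  use (inj i.-1 j.-1); lia.
Qed.

Lemma val_at_delete_at n q (s : 'S_n.+1) p : val_at s q = n -> q <= n -> p < n ->
  val_at (delete_at q s) p = if p < q then val_at s p else val_at s p.+1.
Proof.
move=> sq qn pn; rewrite val_at_perm_of_nat // /permutes; split=> [i|i j] lti.
  have lt1 := @val_at_lt n.+1 s; have inj := @val_at_inj n.+1 s.
  case_ifs.
    by have := inj i q; have := lt1 i; lia.
  by have := inj i.+1 q; have := lt1 i.+1; lia.
have inj := @val_at_inj n.+1 s.
by case_ifs => ltj e; use (inj i j); use (inj i j.+1); use (inj i.+1 j);
  use (inj i.+1 j.+1); lia.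
Qed.

Lemma insert_maxK n q (s : 'S_n) : q <= n -> delete_at q (insert_max q s) = s.
Proof.
move=> qn; apply: eq_val_at => p pn.
rewrite val_at_delete_at ?val_at_insert_max ?ltnn ?eqxx //; try lia.
by case_ifs => //; lia.
Qed.

Lemma delete_atK n q (s : 'S_n.+1) :
  q <= n -> val_at s q = n -> insert_max q (delete_at q s) = s.
Proof.
move=> qn sq; apply: eq_val_at => p pn; rewrite val_at_insert_max //.
case: ifP => pq; first by rewrite val_at_delete_at ?pq //; lia.
case: eqP => [-> //|pq']; rewrite val_at_delete_at //; last by lia.
by rewrite ifN ?prednK //; lia.
Qed.

Definition pos_max n (s : 'S_n.+1) : nat := (s^-1)%g ord_max.

Lemma val_at_pos_max n (s : 'S_n.+1) : val_at s (pos_max s) = n.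
Proof. by rewrite /pos_max val_atE permKV. Qed.

Lemma pos_max_le n (s : 'S_n.+1) : pos_max s <= n.
Proof. by rewrite -ltnS ltn_ord. Qed.

Lemma pos_max_insert n q (s : 'S_n) : q <= n -> pos_max (insert_max q s) = q.
Proof.
move=> qn; apply: (@val_at_inj n.+1 (insert_max q s)); rewrite ?ltnS ?pos_max_le //.
by rewrite val_at_pos_max val_at_insert_max // ltnn eqxx.
Qed.

(** The new maximum plays the role of the 3 in a 321 pattern, so the entries to
its right have to increase. *)
Lemma av321_insert n q (s : 'S_n) : q <= n ->
  (insert_max q s \in av perm321 n.+1) =
  (s \in av perm321 n) && incr_from q s.
Proof.
move=> qn; have lt1 k := @val_at_lt n s k.
apply/av321P/andP => [no|[/av321P no /incr_fromP inc] a b c ab bc cn].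
  split; [apply/av321P => a b c ab bc cn | apply/incr_fromP => i j qi ij jn].
    pose up p := if p < q then p else p.+1.
    have upE p : p < n -> val_at (insert_max q s) (up p) = val_at s p.
      move=> pn; rewrite val_at_insert_max //; last by rewrite /up; case: ifP; lia.
      by rewrite /up; case: (ltnP p q) => pq; case_ifs; lia.
    have := no (up a) (up b) (up c); rewrite !upE; try lia; apply; rewrite /up;
      by case_ifs; lia.
  have := no q i.+1 j.+1; rewrite !val_at_insert_max; try lia.
  case_ifs; try lia; move=> h; have {h} := h qi ij jn.
  by have := lt1 i (ltn_trans ij jn); have := @val_at_inj n s i j; lia.
rewrite !val_at_insert_max; try lia.
case_ifs => -[cb ba]; use (lt1 a); use (lt1 b); use (lt1 c);
use (lt1 a.-1); use (lt1 b.-1); use (lt1 c.-1); use (inc b.-1 c.-1);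
use (no a b c); use (no a b c.-1); use (no a b.-1 c.-1);
use (no a.-1 b.-1 c.-1); lia.
Qed.

(** The guard [L <= n] matters because of the truncated subtraction. *)
Definition av321_suffix n L : {set 'S_n} :=
  [set s in av perm321 n | (L <= n) && incr_from (n - L) s].

Lemma incr_from_le n d d' (s : 'S_n) : d <= d' -> incr_from d s -> incr_from d' s.
Proof. by move=> dd' /incr_fromP h; apply/incr_fromP => i j *; apply: h; lia. Qed.

(** Either the new maximum comes last and prolongs the final increasing run, or
it has at least [L.+1] entries to its right, all increasing by avoidance. *)
Lemma insert_suffix n L q (s : 'S_n) : q <= n ->
  (insert_max q s \in av321_suffix n.+1 L.+1) =
  (s \in av perm321 n) && ((q == n) && (L <= n) && incr_from (n - L) s
                           || (q + L < n) && incr_from q s).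
Proof.
move=> qn; rewrite inE av321_insert // -andbA; case: (s \in av _ _) => //=.
have lt1 k := @val_at_lt n s k.
rewrite subSS ltnS.
have [Ln|Ln] := leqP L n; last by rewrite !andbF; case: (ltnP (q + L) n) => //; lia.
apply/andP/orP => [[/incr_fromP incq /incr_fromP inc]|].
  have [qn'|qn'] := eqVneq q n.
    left; apply/incr_fromP => i j Li ij jn; have := inc i j Li ij (ltnW jn).
    by rewrite !val_at_insert_max; try lia; rewrite !ifT; lia.
  right; apply/andP; split; last exact/incr_fromP.
  rewrite ltnNge; apply/negP => Lq; have := inc q q.+1.
  rewrite !val_at_insert_max; try lia.
  by use (lt1 q); case_ifs; lia.
case=> /andP.
  case=> [/andP [/eqP -> _] /incr_fromP inc]; split; apply/incr_fromP => i j.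
    by lia.
  move=> di ij jn; rewrite !val_at_insert_max; try lia.
  by case_ifs; use (inc i j); use (lt1 i); lia.
case=> qL /incr_fromP inc; split; apply/incr_fromP => // i j di ij jn.
rewrite !val_at_insert_max; try lia.
by case_ifs; use (inc i.-1 j.-1); lia.
Qed.

(** The permutations of size [n.+1] whose final increasing run has length
exactly [L.+1] arise from those of size [n] whose run has length at least [L]:
the maximum is put last if the run has length exactly [L], and in front of the
last [L.+1] entries if the run is longer. *)
Lemma card_suffix_rec n L : L <= n ->
  #|av321_suffix n.+1 L.+1| = #|av321_suffix n.+1 L.+2| + #|av321_suffix n L|.
Proof.
move=> Ln; rewrite -(cardsID (av321_suffix n.+1 L.+2)); congr (_ + _).
  apply: eq_card => s; rewrite !inE !subSS; case: (contains s _) => //=.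
  apply: andb_idl => /andP [Ln' /(incr_from_le _)-> //]; last by lia.
  by rewrite andbT; lia.
have n_lt k : (n + k < n) = false by lia.
pose pos (s : 'S_n) := if s \in av321_suffix n L.+1 then n - L.+1 else n.
have posn s : pos s <= n by rewrite /pos; case: ifP; lia.
apply: (card_bij_in (f := fun s => delete_at (pos_max s) s)
                    (g := fun s => insert_max (pos s) s)) => [t|s].
  have qn := pos_max_le t; have := delete_atK qn (val_at_pos_max t).
  set q := pos_max t in qn *; set s := delete_at q t => <-.
  rewrite inE !insert_suffix // /pos !inE.
  case: (contains s _) => //=; rewrite Ln /= => /andP [].
  rewrite negb_or !negb_and.
  have [->|qn'] := eqVneq q n => /=.
    rewrite !n_lt /= andbT orbF.
    by case: (L < n) => //= /negPf -> ->.
  move=> + /andP [qL inc]; rewrite inc orbF -leqNgt => qL'.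
  have qE : q = n - L.+1 by lia.
  rewrite -qE inc (incr_from_le _ inc) ?qE; last by lia.
  by rewrite andbT; have -> : L < n by lia.
rewrite inE => /andP [sav /andP [_ inc]].
rewrite pos_max_insert // insert_maxK //; split=> //.
rewrite inE !insert_suffix // sav /= /pos [s \in av321_suffix _ _]inE sav /= Ln inc.
have [Ln'|] /= := ltnP L n; last by rewrite eqxx !n_lt.
have [inc' /=|ninc /=] := boolP (incr_from (n - L.+1) s).
  by rewrite inc' !andbT; lia.
by rewrite eqxx !n_lt.
Qed.

Lemma card_suffix_gt n L : n < L -> #|av321_suffix n L| = 0.
Proof.
move=> nL; apply/eqP; rewrite cards_eq0 -subset0; apply/subsetP => s.
by rewrite inE leqNgt nL andbF.
Qed.

(** A single entry always forms an increasing run. *)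
Lemma card_suffix0 n : #|av321_suffix n.+1 0| = #|av321_suffix n.+1 1|.
Proof.
apply: eq_card => s; rewrite !inE; congr (_ && _) => /=.
by apply/incr_fromP/incr_fromP => inc i j *; apply: inc; lia.
Qed.

(** Double induction: on [n], and on [d = n - L] downwards from the longest
run; the recurrence reduces to Pascal's rule and to the absorption identity
[mul_bin_left]. *)
Lemma card_suffix n L : L <= n ->
  n.+1 * #|av321_suffix n L| = L.+1 * 'C(2 * n - L, n).
Proof.
elim: n L => [|n IHn] L.
  rewrite leqn0 => /eqP ->; rewrite bin0 !mul1n.
  have <- : #|[set: 'S_0]| = 1 by rewrite cardsT card_Sn.
  apply: eq_card => s; rewrite !in_set; apply/andP; split; last first.
    by apply/incr_fromP => i j *; lia.
  have : s \in av perm321 0 by apply/av321P => a b c *; lia.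
  by rewrite inE.
have succ d : d <= n -> n.+2 * #|av321_suffix n.+1 (n - d).+1|
                        = (n - d).+2 * 'C(2 * n.+1 - (n - d).+1, n.+1).
  elim: d => [_|d IHd dn].
    rewrite subn0 card_suffix_rec // card_suffix_gt // add0n.
    have -> : 2 * n.+1 - n.+1 = n.+1 by lia.
    have := IHn n (leqnn n); have -> : 2 * n - n = n by lia.
    by rewrite !binn; nia.
  rewrite card_suffix_rec ?leq_subr //.
  have hx := IHd (ltnW dn); have hy := IHn (n - d.+1) (leq_subr _ _).
  have uv := mul_bin_left (n + d.+1) n; move: hx hy uv.
  have -> : 2 * n - (n - d.+1) = n + d.+1 by lia.
  have -> : 2 * n.+1 - (n - d).+1 = (n + d.+1) by lia.
  have -> : 2 * n.+1 - (n - d.+1).+1 = (n + d.+1).+1 by lia.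
  rewrite binS addKn; have -> : (n - d.+1).+2 = (n - d).+1 by lia.
  have -> : (n - d.+1).+1 = n - d by lia.
  move: #|_| #|av321_suffix n _| => x y.
  move: 'C(_, n.+1) 'C(_, n) (n - d) (subnK (ltnW dn)) => v u M Mn hx hy uv.
  apply/eqP; rewrite -(eqn_pmul2l (ltn0Sn n)) -Mn in hx hy uv *; apply/eqP.
  move: hx hy uv => /(congr1 (muln (M + d).+1)) hx /(congr1 (muln (M + d).+2)) hy.
  by move: hx hy; clear; lia.
case: L => [_|L Ln].
  have := succ n (leqnn n); rewrite subnn card_suffix0 => ->.
  have -> : 2 * n.+1 - 0 = (2 * n + 1).+1 by lia.
  have -> : 2 * n.+1 - 1 = 2 * n + 1 by lia.
  rewrite binS -(bin_sub (n := 2 * n + 1) (m := n)); last by lia.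
  have -> : 2 * n + 1 - n = n.+1 by lia.
  by rewrite mul1n mulSn mul1n.
by have := succ (n - L) (leq_subr _ _); rewrite subKn.
Qed.

Lemma card_av321 n : n.+1 * #|av perm321 n| = 'C(2 * n, n).
Proof.
have := @card_suffix n 0 isT; rewrite mul1n subn0 => <-; congr (_ * _).
apply: eq_card => s; rewrite [in RHS]inE; apply/esym/andb_idr => _.
by apply/incr_fromP => i j *; lia.
Qed.

(** * The Catalan convolution and strong fixed points *)

Lemma card_av321_0 : #|av perm321 0| = 1.
Proof. by have := card_av321 0; rewrite mul1n. Qed.

Lemma card_av321_rec n :
  n.+2 * #|av perm321 n.+1| = (4 * n + 2) * #|av perm321 n|.
Proof.
apply/eqP; rewrite -(eqn_pmul2l (ltn0Sn n)) card_av321; apply/eqP.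
have := card_av321 n; have := mul_bin_diag (2 * n).+1 n.
have -> : 2 * n.+1 = (2 * n).+2 by lia.
rewrite (binS (2 * n).+1) -(bin_sub (n := (2 * n).+1) (m := n)); last by lia.
have -> : (2 * n).+1 - n = n.+1 by lia.
rewrite /= => hB /(congr1 (muln (4 * n + 2))); lia.
Qed.

(** Pairing [i] with [n - i] shows that weighting the convolution [S n] by [i]
multiplies it by [n / 2].  Weighting [S n.+1] by [i.+1] and applying the
first-order recurrence to each term thus expresses [S n.+1] through [S n]. *)
Lemma convolution_catalan (c : nat -> nat) :
  c 0 = 1 -> (forall n, n.+2 * c n.+1 = (4 * n + 2) * c n) ->
  forall n, \sum_(i < n.+1) c i * c (n - i) = c n.+1.
Proof.
move=> c0 cS.
pose S n := \sum_(i < n.+1) c i * c (n - i).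
pose T n := \sum_(i < n.+1) i * (c i * c (n - i)).
have TS n : 2 * T n = n * S n.
  have TR : T n = \sum_(i < n.+1) (n - i) * (c i * c (n - i)).
    rewrite /T (reindex_inj rev_ord_inj) /=; apply: eq_bigr => i _.
    by rewrite subSS subKn -1?ltnS // [c (n - i) * _]mulnC.
  rewrite mul2n -addnn {2}TR /T -big_split /S big_distrr; apply: eq_bigr => i _ /=.
  by rewrite -mulnDl subnKC -1?ltnS.
have TrecS n : T n.+1 + S n.+1 = c n.+1 + (4 * T n + 2 * S n).
  have -> : T n.+1 + S n.+1 = \sum_(i < n.+2) i.+1 * (c i * c (n.+1 - i)).
    by rewrite addnC -big_split; apply: eq_bigr.
  rewrite big_ord_recl /= c0 subn0 !mul1n; congr (_ + _).
  rewrite !big_distrr -big_split; apply: eq_bigr => i _ /=.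
  rewrite /bump add1n subSS; have := cS i.
  by move: (c i.+1) (c i) (c (n - i)) => x y z /(congr1 (muln z)); lia.
elim=> [|n IHn]; first by have := cS 0; rewrite big_ord1 c0; lia.
have h1 := TrecS n; have h2 := TS n; have h3 := TS n.+1; have h4 := cS n.+1.
move: IHn h1 h2 h3 h4; rewrite -/(S n) -/(S n.+1) => ->.
move: (S _) (T _) (T _) (c n.+1) (c n.+2) => s t t' x y h1 h2 h3 h4.
apply/eqP; rewrite -(eqn_pmul2l (isT : 0 < n.+3)) ; apply/eqP; nia.
Qed.

(** No inversion involves the position [m]; that [m] is then a fixed point is a
consequence ([strong_fixed_val]). *)
Definition strong_fixed n m (s : 'S_n) : bool :=
  [forall i : 'I_n, (i < m) == (s i < val_at s m)].

Lemma strong_fixedP n m (s : 'S_n) :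
  reflect (forall i, i < n -> (i < m) = (val_at s i < val_at s m))
          (strong_fixed m s).
Proof.
apply: (iffP forallP) => h i; last by rewrite -!val_atE h.
by move=> lti; have /eqP := h (Ordinal lti); rewrite -val_atE.
Qed.

Lemma card_ord_lt n v : v <= n -> #|[set i : 'I_n | i < v]| = v.
Proof.
by move=> vn; rewrite -sum1dep_card (big_ord_narrow vn) /= sum1_card card_ord.
Qed.

(** As many values lie below the value at [m] as positions lie before [m]. *)
Lemma strong_fixed_val n m (s : 'S_n) :
  m < n -> strong_fixed m s -> val_at s m = m.
Proof.
move=> mn /forallP h; rewrite -[RHS](card_ord_lt (ltnW mn)).
rewrite -[LHS](card_ord_lt (ltnW (val_at_lt s mn))).
rewrite -[in LHS](card_imset _ (@perm_inj _ (s^-1)%g)); apply: eq_card => i.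
rewrite inE (eqP (h i)); apply/imsetP/idP => [[j]|lt].
  by rewrite inE => ? ->; rewrite permKV.
by exists (s i); rewrite ?inE ?permK.
Qed.

Section DirectSum.
Variables (n m : nat) (mn : m < n).

Definition join_fixed (a : 'S_m) (b : 'S_(n - m.+1)) : 'S_n :=
  perm_of_nat n (fun p => if p < m then val_at a p else if p == m then m
                          else m.+1 + val_at b (p - m.+1)).

Definition left_part (s : 'S_n) : 'S_m := perm_of_nat m (val_at s).

Definition right_part (s : 'S_n) : 'S_(n - m.+1) :=
  perm_of_nat (n - m.+1) (fun p => val_at s (m.+1 + p) - m.+1).

Lemma val_at_join_fixed a b p : p < n -> val_at (join_fixed a b) p =
  if p < m then val_at a p else if p == m then m
                          else m.+1 + val_at b (p - m.+1).
Proof.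
move=> pn; rewrite val_at_perm_of_nat // /permutes /=.
have lta := @val_at_lt m a; have ltb := @val_at_lt _ b.
have inja := @val_at_inj m a; have injb := @val_at_inj _ b.
split=> [i|i j] lti.
  by case_ifs; use (lta i); use (ltb (i - m.+1)); lia.
by case_ifs => ltj e; use (lta i); use (ltb (i - m.+1)); use (lta j);
  use (ltb (j - m.+1)); use (inja i j); use (injb (i - m.+1) (j - m.+1)); lia.
Qed.

Lemma val_at_parts s : strong_fixed m s ->
  (forall p, p < m -> val_at (left_part s) p = val_at s p) /\
  (forall p, p < n - m.+1 ->
     m.+1 + val_at (right_part s) p = val_at s (m.+1 + p)).
Proof.
move=> st; have sm := strong_fixed_val mn st; move: st => /strong_fixedP st.
have lts := @val_at_lt n s; have injs := @val_at_inj n s.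
have right i : m < i -> i < n -> m < val_at s i.
  move=> mi iltn; have := st i iltn; have := injs i m iltn mn; rewrite sm; lia.
split=> p pn; rewrite val_at_perm_of_nat //.
- split=> [i im|i j im jm]; last by apply: injs; lia.
  by have := st i; rewrite sm; lia.
- by have := right (m.+1 + p); lia.
split=> [i im|i j im jm].
  by use (right (m.+1 + i)); use (lts (m.+1 + i)); lia.
move=> e; use (right (m.+1 + i)); use (right (m.+1 + j)).
by use (injs (m.+1 + i) (m.+1 + j)); lia.
Qed.

(** Around such a point the permutation is a direct sum, and no 321 pattern can
use points of two different summands. *)
Lemma card_strong_fixed :
  #|[set s in av perm321 n | strong_fixed m s]|
    = #|av perm321 m| * #|av perm321 (n - m.+1)|.
Proof.
rewrite -cardsX; apply: (card_bij_in (f := fun s => (left_part s, right_part s))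
  (g := fun ab => join_fixed ab.1 ab.2)).
  move=> s; rewrite inE => /andP [/av321P no st].
  have [eq1 eq2] := val_at_parts st.
  split.
    rewrite in_setX; apply/andP; split; apply/av321P => a b c ab bc cn.
      by rewrite !eq1; try lia; apply: no; lia.
    use (no (m.+1 + a) (m.+1 + b) (m.+1 + c)).
    by use (eq2 a); use (eq2 b); use (eq2 c); lia.
  apply: eq_val_at => p pn; rewrite val_at_join_fixed //.
  case_ifs; first exact: eq1.
    by rewrite -(strong_fixed_val mn st); congr val_at; lia.
  by rewrite eq2; [congr val_at; lia | lia].
case=> a b; rewrite in_setX => /andP [/= /av321P noa /av321P nob].
have lta := @val_at_lt m a; have ltb := @val_at_lt _ b.
have vE := val_at_join_fixed a b.
have st : strong_fixed m (join_fixed a b).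
  apply/strong_fixedP => i iltn; rewrite !vE //= ltnn eqxx.
  by case_ifs; use (lta i); lia.
have [eq1 eq2] := val_at_parts st.
split.
  rewrite inE st andbT; apply/av321P => x y z xy yz zn; rewrite !vE; try lia.
  rewrite /=; case_ifs; use (lta x); use (lta y); use (lta z);
   use (noa x y z); use (nob (x - m.+1) (y - m.+1) (z - m.+1)); lia.
congr (_, _); apply: eq_val_at => p pn.
  by rewrite eq1 // vE ?pn //; lia.
apply: (@addnI m.+1); rewrite eq2 // vE /=; last by lia.
by case_ifs; try lia; congr (_ + val_at _ _); lia.
Qed.
End DirectSum.

(** On average a 321-avoider has exactly one strong fixed point. *)
Lemma sum_card_strong_fixed n :
  \sum_(m < n.+1) #|[set s in av perm321 n.+1 | strong_fixed m s]|
    = #|av perm321 n.+1|.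
Proof.
rewrite -[RHS](convolution_catalan card_av321_0 card_av321_rec).
by apply: eq_bigr => m _; rewrite card_strong_fixed.
Qed.

(** * Inflating a point into a cluster *)

(** The equality of value sets in [cluster_at] follows from the pointwise
condition, because [tau] is onto. *)
Lemma cluster_atP k n (tau : 'S_k) (s : 'S_n) l m :
  l + k <= n -> m + k <= n ->
  reflect (forall i, i < k -> val_at s (m + i) = l + val_at tau i)
          (cluster_at tau s l m).
Proof.
move=> ln mn; apply: (iffP andP) => [[_ /forallP cl] i ik|cl].
  have mi : m + i < n by lia.
  have /forallP/(_ (Ordinal mi))/implyP := cl (Ordinal ik).
  by rewrite -!val_atE => /(_ (eqxx _))/eqP.
split; last first.
  apply/forallP => i; apply/forallP => p; apply/implyP => /eqP pE.
  by rewrite -!val_atE pE cl.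
apply/eqP/setP => v; rewrite inE; apply/idP/imsetP => [lv|[p]].
  have [|i ik iE] := @val_at_surj k tau (v - l); first lia.
  have mi : m + i < n by lia.
  exists (Ordinal mi); first by rewrite inE /=; lia.
  by apply: val_inj; rewrite /= -val_atE cl // iE; lia.
rewrite inE => mp ->; rewrite -val_atE -(subnKC (proj1 (andP mp))) cl; last lia.
by have := @val_at_lt k tau (p - m); lia.
Qed.

Section Inflation.
Variables (n k : nat).
Hypotheses (k_gt0 : 0 < k) (k_le : k <= n).
Local Notation N := (n.+1 - k).

(** The same map shrinks a block of [k] positions or of [k] values starting at
[l] to the single point [l]. *)
Definition contract l v := if v < l then v else if v < l + k then l else v - k.-1.

Lemma contract_out m i : m < N -> i < n -> ~~ (m <= i < m + k) ->
  contract m i < N /\ contract m i != m.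
Proof. by rewrite /contract => *; case_ifs; lia. Qed.

Lemma contract_inj m i j : ~~ (m <= i < m + k) -> ~~ (m <= j < m + k) ->
  contract m i = contract m j -> i = j.
Proof. by rewrite /contract => hi hj; case_ifs; lia. Qed.

(** A section of [contract m], which sends [m] to the start of its block. *)
Definition expand m q := if q <= m then q else q + k.-1.

Lemma expand_out m q : m < N -> q < N ->
  expand m q < n /\ (q != m -> ~~ (m <= expand m q < m + k)).
Proof. by rewrite /expand => *; case_ifs; lia. Qed.

Lemma expand_id m : expand m m = m.
Proof. by rewrite /expand leqnn. Qed.

Lemma expandK m q : contract m (expand m q) = q.
Proof. by rewrite /contract /expand; case_ifs; lia. Qed.

(** Values above the inflated point move up by [k.-1]. *)
Definition inflate (tau : 'S_k) (pi : 'S_N) m : 'S_n :=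
  perm_of_nat n (fun p =>
    if m <= p < m + k then val_at pi m + val_at tau (p - m)
    else let v := val_at pi (contract m p) in
         if v < val_at pi m then v else v + k.-1).

Definition collapse (s : 'S_n) l m : 'S_N :=
  perm_of_nat N (fun q => contract l (val_at s (expand m q))).

Lemma val_at_inflate (tau : 'S_k) (pi : 'S_N) m p : m < N -> p < n ->
  val_at (inflate tau pi m) p =
    if m <= p < m + k then val_at pi m + val_at tau (p - m)
    else let v := val_at pi (contract m p) in
         if v < val_at pi m then v else v + k.-1.
Proof.
move=> mN pn; rewrite val_at_perm_of_nat // /permutes /=.
have ltp := @val_at_lt N pi; have ltt := @val_at_lt k tau.
have injp := @eqn_val_at N pi; have injt := @eqn_val_at k tau.
have ltm := ltp m mN.
split=> [i|i j] lti.
  case: (boolP (m <= i < m + k)) => hi; first by use (ltt (i - m)); lia.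
  have [cN cm] := contract_out mN lti hi.
  by use (ltp (contract m i)); use (injp (contract m i) m); case_ifs; lia.
move=> ltj; case: (boolP (m <= i < m + k)) => hi;
  case: (boolP (m <= j < m + k)) => hj.
- by move=> e; use (injt (i - m) (j - m)); lia.
- have [cN cm] := contract_out mN ltj hj.
  by use (ltt (i - m)); use (injp (contract m j) m); case_ifs; lia.
- have [cN cm] := contract_out mN lti hi.
  by use (ltt (j - m)); use (injp (contract m i) m); case_ifs; lia.
have [cN cm] := contract_out mN lti hi; have [cN' cm'] := contract_out mN ltj hj.
use (injp (contract m i) m); use (injp (contract m j) m).
use (injp (contract m i) (contract m j)).
by case_ifs => e; apply: (contract_inj hi hj); lia.
Qed.

Lemma inflate_cluster (tau : 'S_k) (pi : 'S_N) m : m < N ->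
  cluster_at tau (inflate tau pi m) (val_at pi m) m.
Proof.
move=> mN; have := @val_at_lt N pi m mN => ltm.
apply/cluster_atP; try lia; move=> i ik; rewrite val_at_inflate //; last lia.
by rewrite ifT ?addKn //; lia.
Qed.

(** The formula defining [collapse] permutes: block positions are exactly the
positions with block values, and [contract l] is injective elsewhere. *)
Lemma val_at_collapse (tau : 'S_k) (s : 'S_n) l m q :
  l < N -> m < N -> cluster_at tau s l m -> q < N -> val_at (collapse s l m) q =
           contract l (val_at s (expand m q)).
Proof.
move=> lN mN /cluster_atP cl qN; have {}cl := cl ltac:(lia) ltac:(lia).
have lts := @val_at_lt n s; have injs := @eqn_val_at n s.
have out p : p < n -> l <= val_at s p < l + k -> m <= p < m + k.
  move=> pn /andP [lp pl].
  have [|i ik iE] := @val_at_surj k tau (val_at s p - l); first lia.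
  by have := injs p (m + i) pn; rewrite cl // iE; lia.
have lt0 := @val_at_lt k tau 0 k_gt0.
have clm := cl 0 k_gt0; rewrite addn0 in clm.
have cm : contract l (val_at s m) = l by rewrite /contract; case_ifs; lia.
have eout i : i < N -> i != m -> ~~ (l <= val_at s (expand m i) < l + k).
  move=> iN im; have [en /(_ im)] := expand_out mN iN.
  by apply: contra; apply: out.
have ein i := @expand_out m i mN.
rewrite val_at_perm_of_nat // /permutes; split=> [i|i j] iN.
  have [->|im] := eqVneq i m; first by rewrite expand_id cm.
  have [en _] := ein i iN.
  by case: (contract_out lN (lts _ en) (eout i iN im)).
have [-> jN|im jN] := eqVneq i m; have [->|jm] // := eqVneq j m.
- rewrite expand_id cm => e; have [en _] := ein j jN.
  by case: (contract_out lN (lts _ en) (eout j jN jm)); rewrite -e eqxx.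
- rewrite expand_id cm => e; have [en _] := ein i iN.
  by case: (contract_out lN (lts _ en) (eout i iN im)); rewrite e eqxx.
move=> /(contract_inj (eout i iN im) (eout j jN jm)) /eqP.
rewrite injs; try by [case: (ein i iN) | case: (ein j jN)].
by move=> /eqP e; rewrite -(expandK m i) e expandK.
Qed.

Lemma collapse_id (tau : 'S_k) (s : 'S_n) l m :
  l < N -> m < N -> cluster_at tau s l m ->
  val_at (collapse s l m) m = l.
Proof.
move=> lN mN cl; rewrite (val_at_collapse lN mN cl mN) expand_id.
move: cl => /cluster_atP cl; have := cl ltac:(lia) ltac:(lia) 0 k_gt0.
rewrite addn0 => ->; have := @val_at_lt k tau 0 k_gt0.
by rewrite /contract; case_ifs; lia.
Qed.

Lemma expand_contract m p : ~~ (m <= p < m + k) -> expand m (contract m p) = p.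
Proof. by rewrite /expand /contract; case_ifs; lia. Qed.

Lemma collapseK (tau : 'S_k) (s : 'S_n) l m :
  l < N -> m < N -> cluster_at tau s l m ->
  inflate tau (collapse s l m) m = s.
Proof.
move=> lN mN cl; apply: eq_val_at => p pn; rewrite val_at_inflate //.
rewrite (collapse_id lN mN cl).
have [/andP [mp pm]|out] := boolP (m <= p < m + k).
  have /cluster_atP {}cl := cl; rewrite -cl; try lia; congr val_at; lia.
have [cN cm] := contract_out mN pn out.
rewrite (val_at_collapse lN mN cl cN) expand_contract //.
have vn : ~~ (l <= val_at s p < l + k).
  apply: contra out => /andP [lp pl]; have /cluster_atP {}cl := cl.
  have [|i ik iE] := @val_at_surj k tau (val_at s p - l); first lia.
  have := @eqn_val_at n s p (m + i) pn; rewrite cl ?iE; lia.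
by rewrite /= /contract; case_ifs; lia.
Qed.

Lemma inflateK (tau : 'S_k) (pi : 'S_N) m : m < N ->
  collapse (inflate tau pi m) (val_at pi m) m = pi.
Proof.
move=> mN; apply: eq_val_at => q qN.
have pN := @val_at_lt N pi m mN.
have cl := inflate_cluster tau pi mN.
rewrite (val_at_collapse pN mN cl qN).
have [->|qm] := eqVneq q m.
  by rewrite -(val_at_collapse pN mN cl mN) (collapse_id pN mN cl).
have [en /(_ qm) out] := expand_out mN qN.
rewrite val_at_inflate // (negPf out) expandK /=.
by have := @eqn_val_at N pi q m qN mN; rewrite /contract; case_ifs; lia.
Qed.

(** The relative order in an inflation is lexicographic: first compare the
points of [pi], then, inside the block, the entries of [tau].  Outside the
block two positions contract to the same point only if they are equal, and both
sides are then false. *)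
Lemma val_at_inflate_lt (tau : 'S_k) (pi : 'S_N) m p q :
  m < N -> p < n -> q < n ->
  (val_at (inflate tau pi m) p < val_at (inflate tau pi m) q) =
  if contract m p == contract m q
  then val_at tau (p - m) < val_at tau (q - m)
  else val_at pi (contract m p) < val_at pi (contract m q).
Proof.
move=> mN pn qn; rewrite !val_at_inflate //.
have inb i : m <= i < m + k -> contract m i = m.
  by rewrite /contract; case_ifs; lia.
have ltt := @val_at_lt k tau; have injp := @eqn_val_at N pi.
case: (boolP (m <= p < m + k)) => hp;
  case: (boolP (m <= q < m + k)) => hq.
- by rewrite !inb // eqxx ltn_add2l.
- have [cN cm] := contract_out mN qn hq; rewrite (inb p) // ifN.
    by use (ltt (p - m)); use (injp (contract m q) m); rewrite /=; case_ifs; lia.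
  by rewrite eq_sym.
- have [cN cm] := contract_out mN pn hp; rewrite (inb q) // ifN //.
  by use (ltt (q - m)); use (injp (contract m p) m); rewrite /=; case_ifs; lia.
have [cN cm] := contract_out mN pn hp; have [cN' cm'] := contract_out mN qn hq.
use (injp (contract m p) m); use (injp (contract m q) m).
have [e|ne] := eqVneq (contract m p) (contract m q).
  by rewrite (contract_inj hp hq e) !ltnn.
by rewrite /=; case_ifs; lia.
Qed.

Lemma contract_le m p q : p <= q -> contract m p <= contract m q.
Proof. by rewrite /contract; case_ifs; lia. Qed.

Lemma contract_eq m p q : p < q -> contract m p = contract m q ->
  [/\ contract m p = m, m <= p & q < m + k].
Proof. by rewrite /contract => pq; case_ifs => e; split; lia. Qed.

Lemma contract_lt_N m p : m < N -> p < n -> contract m p < N.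
Proof. by rewrite /contract => *; case_ifs; lia. Qed.

Lemma monotone_perm_id (t : 'S_k) :
  (forall i j, i < j -> j < k -> val_at t i < val_at t j) -> t = 1%g.
Proof.
move=> mono; have ltt := @val_at_lt k t.
(* Below the value at [i] lie [i] values, and above it [k.-1 - i]. *)
have up i : i < k -> i <= val_at t i.
  elim: i => // i IHi ik; have := mono i i.+1 (ltnSn i) ik.
  by have := IHi (ltnW ik); lia.
have down d : d < k -> val_at t (k.-1 - d) <= k.-1 - d.
  elim: d => [|d IHd] dk; first by have := ltt (k.-1 - 0) ltac:(lia); lia.
  have := mono (k.-1 - d.+1) (k.-1 - d) ltac:(lia) ltac:(lia).
  by have := IHd (ltnW dk); lia.
apply: eq_val_at => i ik; rewrite -[i in RHS]/(val (Ordinal ik)) val_atE perm1 /=.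
have := up i ik; have := down (k.-1 - i) ltac:(lia).
by rewrite (_ : k.-1 - (k.-1 - i) = i); lia.
Qed.

Lemma val_at1 i : val_at (1%g : 'S_k) i = i.
Proof. by rewrite /val_at; case: insubP => //= j _ <-; rewrite perm1. Qed.

(** A 321 pattern that meets the block in two points needs an inversion inside
[tau] and an inversion of [pi] through [m]; each of them is available unless
[tau] is the identity, respectively [m] is a strong fixed point. *)
Lemma av321_inflate (tau : 'S_k) (pi : 'S_N) m :
  m < N -> tau \in av perm321 k ->
  (inflate tau pi m \in av perm321 n) =
  (pi \in av perm321 N) && ((tau == 1%g) || strong_fixed m pi).
Proof.
move=> mN /av321P tau_av; have injp := @eqn_val_at N pi.
apply/av321P/andP => [no|[/av321P pi_av st] a b c ab bc cn [cb ba]].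
  have lt_expand p q : p < N -> q < N -> p != q ->
      (val_at (inflate tau pi m) (expand m p)
         < val_at (inflate tau pi m) (expand m q))
      = (val_at pi p < val_at pi q).
    move=> pN qN pq; have [en _] := expand_out mN pN.
    have [en' _] := expand_out mN qN.
    by rewrite val_at_inflate_lt // !expandK (negPf pq).
  split.
    apply/av321P => a b c ab bc cN [cb ba].
    apply: (no (expand m a) (expand m b) (expand m c)).
    + by rewrite /expand; case_ifs; lia.
    + by rewrite /expand; case_ifs; lia.
    + by case: (expand_out mN cN).
    by rewrite !lt_expand; lia.
  apply/norP => -[/eqP tau1 /strong_fixedP nst].
  (* Otherwise an inversion [i], [j] of [tau] and an inversion of [pi] between
  [m] and some [q] give a 321 pattern. *)
  apply: tau1; apply: monotone_perm_id => i j ij jk; rewrite ltnNge leq_eqVlt.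
  apply/negP => /orP [|tji]; first by rewrite eqn_val_at; lia.
  apply: nst => q qN; apply/idP/idP => [qm|pqm].
    rewrite ltnNge leq_eqVlt; apply/negP => /orP [|pmq].
      by rewrite injp //; lia.
    apply: (no (expand m q) (m + i) (m + j)); rewrite /expand; try by case_ifs; lia.
    rewrite !val_at_inflate_lt; try by case_ifs; lia.
    by rewrite /contract; case_ifs; rewrite ?addKn; lia.
  rewrite ltnNge leq_eqVlt; apply/negP => /orP [/eqP qm|mq].
    by move: pqm; rewrite qm ltnn.
  apply: (no (m + i) (m + j) (expand m q)); rewrite /expand; try by case_ifs; lia.
  rewrite !val_at_inflate_lt; try by case_ifs; lia.
  by rewrite /contract; case_ifs; rewrite ?addKn ?addnK; lia.
(* A 321 pattern of the inflation contracts to three, two or one points. *)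
move: cb ba; rewrite !val_at_inflate_lt; try lia.
have ltN p := @contract_lt_N m p mN.
have cab := contract_le m (ltnW ab); have cbc := contract_le m (ltnW bc).
have [ecb|ncb] := eqVneq (contract m c) (contract m b);
  have [eba|nba] := eqVneq (contract m b) (contract m a).
- have [e1 mb cm] := contract_eq bc (esym ecb).
  have [e2 ma _] := contract_eq ab (esym eba).
  by move=> h1 h2; apply: (tau_av (a - m) (b - m) (c - m)); lia.
(* Here [b] and [c] lie in the block and [a] to its left. *)
- have [e1 mb cm] := contract_eq bc (esym ecb); move=> h1 h2.
  case/orP: st => [/eqP tau1|/strong_fixedP st].
    by move: h1; rewrite tau1 !val_at1; lia.
  by have := st (contract m a) (ltN a ltac:(lia)); move: h2; rewrite e1; lia.
(* Here [a] and [b] lie in the block and [c] to its right. *)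
- have [e1 mb cm] := contract_eq ab (esym eba); move=> h1 h2.
  case/orP: st => [/eqP tau1|/strong_fixedP st].
    by move: h2; rewrite tau1 !val_at1; lia.
  by have := st (contract m c) (ltN c ltac:(lia)); move: h1; rewrite eba e1; lia.
move=> h1 h2; apply: (pi_av (contract m a) (contract m b) (contract m c));
  last by split.
- by move: cab nba; lia.
- by move: cbc ncb; lia.
- exact: ltN.
Qed.

End Inflation.

(** * Counting clusters in 321-avoiding permutations *)

Definition clusters n k (tau : 'S_k)
    : {set 'S_n * ('I_(n.+1 - k) * 'I_(n.+1 - k))} :=
  [set x : 'S_n * ('I_(n.+1 - k) * 'I_(n.+1 - k)) |
    (x.1 \in av perm321 n) && cluster_at tau x.1 x.2.1 x.2.2].

(** The flag [any_point] is true for the identity pattern. *)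
Definition inflatable N (any_point : bool) : {set 'I_N * 'S_N} :=
  [set y : 'I_N * 'S_N |
    (y.2 \in av perm321 N) && (any_point || strong_fixed y.1 y.2)].

Lemma card_clusters_inflatable n k (tau : 'S_k) :
  0 < k -> k <= n -> tau \in av perm321 k ->
  #|clusters n tau| = #|inflatable (n.+1 - k) (tau == 1%g)|.
Proof.
move=> k_gt0 k_le tau_av.
apply: (@card_bij_in _ _ (clusters n tau) (inflatable (n.+1 - k) (tau == 1%g))
  (fun x => (x.2.2, collapse k x.1 x.2.1 x.2.2))
  (fun y => (inflate tau y.2 y.1, (y.2 y.1, y.1)))).
  case=> s [l m]; rewrite inE /= => /andP [s_av cl].
  have sE := collapseK k_gt0 k_le (ltn_ord l) (ltn_ord m) cl.
  have lE := collapse_id k_gt0 k_le (ltn_ord l) (ltn_ord m) cl.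
  split; last by rewrite sE; congr (_, (_, _)); apply: val_inj; rewrite /= -val_atE.
  by rewrite inE /= -(av321_inflate k_gt0 k_le _ (ltn_ord m) tau_av) sE.
case=> m pi; rewrite inE /= => good; split.
  rewrite inE /= (av321_inflate k_gt0 k_le _ (ltn_ord m) tau_av) good /=.
  by rewrite -val_atE; apply: inflate_cluster.
by congr (_, _); rewrite -val_atE; apply: inflateK.
Qed.

Lemma sum_num_cluster_clusters n k (tau : 'S_k) :
  \sum_(s in av perm321 n) num_cluster tau s = #|clusters n tau|.
Proof.
rewrite -sum1dep_card -(pair_big_dep (mem (av perm321 n))
  (fun (s : 'S_n) (lm : 'I_(n.+1 - k) * 'I_(n.+1 - k)) =>
     cluster_at tau s lm.1 lm.2) (fun _ _ => 1)) /=.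
by apply: eq_bigr => s _; rewrite sum1dep_card.
Qed.

Lemma card_inflatable N any_point :
  #|inflatable N any_point| =
  \sum_(m < N) #|[set pi in av perm321 N | any_point || strong_fixed m pi]|.
Proof.
rewrite -sum1dep_card -(pair_big_dep xpredT (fun (m : 'I_N) (pi : 'S_N) =>
  (pi \in av perm321 N) && (any_point || strong_fixed m pi)) (fun _ _ => 1)) /=.
by apply: eq_bigr => s _; rewrite sum1dep_card.
Qed.

Lemma sum_num_cluster n k (tau : 'S_k) :
  0 < k -> k <= n -> tau \in av perm321 k ->
  \sum_(s in av perm321 n) num_cluster tau s =
  (if tau == 1%g then n.+1 - k else 1) * #|av perm321 (n.+1 - k)|.
Proof.
move=> k_gt0 k_le tau_av.
rewrite sum_num_cluster_clusters card_clusters_inflatable // card_inflatable.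
have [_|_] /= := eqVneq tau 1%g.
  rewrite (eq_bigr (fun=> #|av perm321 (n.+1 - k)|)).
    by rewrite sum_nat_const card_ord.
  by move=> m _; apply: eq_card => pi; rewrite inE andbT.
by rewrite mul1n (subSn k_le) sum_card_strong_fixed.
Qed.

(** * Reversal exchanges 123 and 321 *)

Definition rev_perm n (s : 'S_n) : 'S_n := (decr_perm n * s)%g.

Lemma rev_permE n (s : 'S_n) i : rev_perm s i = s (rev_ord i).
Proof. by rewrite permM permE. Qed.

Lemma rev_permK n : involutive (@rev_perm n).
Proof. by move=> s; apply/permP => i; rewrite !rev_permE rev_ordK. Qed.

Lemma val_at_rev_perm n (s : 'S_n) i :
  i < n -> val_at (rev_perm s) i = val_at s (n - i.+1).
Proof.
move=> lti; rewrite -[i in LHS]/(val (Ordinal lti)) val_atE rev_permE.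
by rewrite -val_atE.
Qed.

Lemma contains_rev m n (s : 'S_n) (eta : 'S_m) :
  contains (rev_perm s) (rev_perm eta) = contains s eta.
Proof.
have imp (t : 'S_n) (e : 'S_m) : contains t e -> contains (rev_perm t) (rev_perm e).
  case/existsP=> f /andP [/forallP inc /forallP pat]; apply/existsP.
  exists [ffun i => rev_ord (f (rev_ord i))].
  apply/andP; split; apply/forallP => i; apply/forallP => j; rewrite !ffunE /=.
    apply/implyP => ij; have := forallP (inc (rev_ord j)) (rev_ord i).
    have := ltn_ord (f (rev_ord i)); have := ltn_ord (f (rev_ord j)).
    by move: (ltn_ord i) (ltn_ord j); rewrite /=; lia.
  by rewrite !rev_permE !rev_ordK; apply: (forallP (pat (rev_ord i)) (rev_ord j)).
by apply/idP/idP => /imp; rewrite ?rev_permK.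
Qed.

Lemma perm321_rev : perm321 = rev_perm perm123.
Proof. by rewrite /rev_perm mulg1. Qed.

Lemma av_rev n (s : 'S_n) : (rev_perm s \in av perm321 n) = (s \in av perm123 n).
Proof. by rewrite !inE perm321_rev contains_rev. Qed.

Lemma num_cluster_rev k n (tau : 'S_k) (s : 'S_n) : k <= n ->
  num_cluster (rev_perm tau) (rev_perm s) = num_cluster tau s.
Proof.
move=> kn.
have imp (t : 'S_k) (u : 'S_n) (l m : 'I_(n.+1 - k)) :
    cluster_at t u l m -> cluster_at (rev_perm t) (rev_perm u) l (rev_ord m).
  have := ltn_ord l; have := ltn_ord m => mN lN /cluster_atP cl.
  have {}cl := cl ltac:(lia) ltac:(lia).
  apply/cluster_atP => /=; try lia; move=> i ik.
  rewrite !val_at_rev_perm; try lia; rewrite -cl; last lia.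
  by congr val_at; lia.
pose f (lm : 'I_(n.+1 - k) * 'I_(n.+1 - k)) := (lm.1, rev_ord lm.2).
have fK : involutive f by case=> l m; rewrite /f /= rev_ordK.
apply: (card_bij_in (f := f) (g := f)) => -[l m]; rewrite inE => /imp cl;
  by rewrite fK inE // -1?[tau]rev_permK -1?[s]rev_permK.
Qed.

Lemma perm321_neq123 : perm321 != perm123.
Proof.
by apply/eqP => /permP/(_ ord0)/(congr1 val); rewrite perm1 permE.
Qed.

Lemma card_av (eta : 'S_3) n : eta = perm123 \/ eta = perm321 ->
  #|av eta n| = #|av perm321 n|.
Proof.
case=> -> //; apply: (card_bij_in (f := @rev_perm n) (g := @rev_perm n)) => s.
  by rewrite av_rev rev_permK.
by rewrite -av_rev rev_permK.
Qed.

(** Reversal turns [tau_star] for 123, the decreasing permutation, into the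
identity, the exceptional pattern for 321. *)
Lemma sum_num_cluster_star (eta : 'S_3) n k (tau : 'S_k) :
  eta = perm123 \/ eta = perm321 -> 0 < k -> k <= n -> tau \in av eta k ->
  \sum_(s in av eta n) num_cluster tau s =
  (if tau == tau_star eta k then n.+1 - k else 1) * #|av eta (n.+1 - k)|.
Proof.
move=> heta k_gt0 kn tau_av; rewrite (card_av _ heta); move: tau_av.
case: heta => ->; rewrite /tau_star ?eqxx ?(negPf perm321_neq123) => tau_av.
  rewrite (reindex_inj (inv_inj (@rev_permK n))) /=.
  have -> : (tau == decr_perm k) = (rev_perm tau == 1%g).
    rewrite -(inj_eq (inv_inj (@rev_permK k)) tau); congr (_ == _).
    by apply/permP => i; rewrite rev_permE perm1 permE rev_ordK.
  rewrite -sum_num_cluster // ?av_rev //.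
  apply: eq_big => [s|s _]; first by rewrite -av_rev rev_permK.
  by rewrite -num_cluster_rev // rev_permK.
exact: sum_num_cluster.
Qed.

(** * Expectations *)

Local Open Scope ring_scope.

Lemma catalan_card (R : realFieldType) (eta : 'S_3) n :
  eta = perm123 \/ eta = perm321 -> catalan R n = #|av eta n|%:R.
Proof.
move=> heta; rewrite (card_av _ heta) /catalan -card_av321 natrM mulKf //.
by rewrite pnatr_eq0.
Qed.

Lemma Eav_sum (R : realFieldType) m (eta : 'S_m) n (X : 'S_n -> nat) :
  Eav R eta X = (\sum_(s in av eta n) X s)%:R / #|av eta n|%:R.
Proof.
rewrite /Eav /expectation natr_sum mulr_suml [RHS]big_mkcond.
apply: eq_bigr => s _; rewrite /unif_prob.
by case: (s \in _); rewrite ?mul0r // mulrC.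
Qed.

Theorem theorem2 (R : realFieldType) (eta : 'S_3)
    (heta : eta = perm123 \/ eta = perm321) :
  (forall (n k : nat) (tau : 'S_k), (2 <= k <= n)%N -> tau \in av eta k ->
     Eav R eta (fun s : 'S_n => num_cluster tau s) =
       if tau != tau_star eta k
       then catalan R (n - k + 1) / catalan R n
       else (n - k + 1)%:R * (catalan R (n - k + 1) / catalan R n))
  /\
  (forall n k : nat, (2 <= k <= n)%N ->
     Eav R eta (fun s : 'S_n => num_cluster_all eta k s) =
       catalan R (n - k + 1) * ((n - k)%:R + catalan R k) / catalan R n).
Proof.
split=> [n k tau /andP [k2 kn] tau_av|n k /andP [k2 kn]]; rewrite Eav_sum;
  rewrite !(catalan_card R _ heta) addn1 -subSn //.
  rewrite sum_num_cluster_star //; last by lia.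
  by case: eqP => /= _; rewrite ?mul1n // natrM mulrA.
congr (_ / _); rewrite /num_cluster_all exchange_big /=.
under eq_bigr => tau tau_av do rewrite sum_num_cluster_star ?(ltnW k2) //.
have star_av := tau_star_av k heta.
rewrite -big_distrl natrM mulrC /=; congr (_ * _); rewrite -natrD; congr (_%:R).
rewrite -[in RHS]sum1_card !(bigD1 (tau_star eta k) star_av) /= eqxx.
rewrite (eq_bigr (fun=> 1%N)) => [|tau /andP [_ /negPf -> //]].
by rewrite subSn // addSn addnA addn1.
Qed.
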